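(* Let $S$ be an idempotent semiring. Then the following conditions are equivalent: (1) $\mathcal{R}^+$ is the least distributive lattice congruence on $S$; (2) $S\in\mathbf{RN}$ and $\mathcal{D}^{\bullet}\subseteq\mathcal{R}^+$; (3) $S\in\mathbf{N}$ and $\mathcal{L}^+\subseteq\mathcal{D}^{\bullet}\subseteq\mathcal{R}^+$; (4) $\leq^{r}_{+}\;\subseteq\;\leq_{\cdot}$ on $S$; (5) $S$ satisfies the identity $x=(y+x)x(y+x)$; (6) $S$ satisfies the identity $x=yxy+x$.
   Context: A semiring $(S,+,\cdot)$ is a set with two associative binary operations such that $x(y+z)=xy+xz$ and $(x+y)z=xz+yz$ (no commutativity assumed). An idempotent semiring is a semiring satisfying $x+x=x$ and $x\cdot x=x$. $\mathcal{L}^+,\mathcal{R}^+$ denote Green's relations of $(S,+)$ and $\mathcal{D}^{\bullet}$ denotes Green's relation $\mathcal{D}$ of $(S,\cdot)$; for an idempotent semiring: $a\,\mathcal{L}^+\,b$ iff $a+b=a$ and $b+a=b$; $a\,\mathcal{R}^+\,b$ iff $a+b=b$ and $b+a=a$; $a\,\mathcal{D}^{\bullet}\,b$ iff $aba=a$ and $bab=b$. The relations $\leq^r_+$ and $\leq_\cdot$ are defined by: $a\leq^r_+ b$ iff $b=b+a$; $a\leq_\cdot b$ iff $a=ba$ and $a=ab$. $\mathbf{N}$ is the variety of idempotent semirings satisfying $x+xyx+x=x$, and $\mathbf{RN}$ is the variety of idempotent semirings satisfying $xyx+x=x$. A distributive lattice is regarded as a semiring (join as $+$, meet as $\cdot$);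 a distributive lattice congruence on $S$ is a semiring congruence whose quotient is a distributive lattice. *)

(* Defs.v *)
From Stdlib Require Export Relation_Definitions.
From mathcomp Require Export all_boot all_order.
From mathcomp Require Export boolp.

Import Order.TTheory.

Set Implicit Arguments.
Unset Strict Implicit.
Unset Printing Implicit Defensive.

(* MathComp's semirings have 0 and 1 and a commutative addition, so they do not
   apply here. *)
Record semiring := Semiring {
  sr_sort :> Type;
  sr_add : sr_sort -> sr_sort -> sr_sort;
  sr_mul : sr_sort -> sr_sort -> sr_sort;
  sr_addA : associative sr_add;
  sr_mulA : associative sr_mul;
  sr_mulDl : left_distributive sr_mul sr_add;
  sr_mulDr : right_distributive sr_mul sr_add }.

Declare Scope semiring_scope.
Delimit Scope semiring_scope with SR.
Bind Scope semiring_scope with sr_sort.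
Notation "x + y" := (sr_add x y) : semiring_scope.
Notation "x * y" := (sr_mul x y) : semiring_scope.
Local Open Scope quotient_scope.
Local Open Scope semiring_scope.

Definition idempotent_semiring (S : semiring) : Prop :=
  (forall x : S, x + x = x) /\ (forall x : S, x * x = x).

Definition variety_N (S : semiring) : Prop :=
  idempotent_semiring S /\ (forall x y : S, x + x * y * x + x = x).

Definition variety_RN (S : semiring) : Prop :=
  idempotent_semiring S /\ (forall x y : S, x * y * x + x = x).

Section Green.
Variables (T : Type) (op : T -> T -> T).

(* The principal ideals T^1 a and a T^1. *)
Definition left_ideal1 (a x : T) : Prop := x = a \/ exists s, x = op s a.
Definition right_ideal1 (a x : T) : Prop := x = a \/ exists s, x = op a s.

Definition greenL : relation T :=
  fun a b => forall x, left_ideal1 a x <-> left_ideal1 b x.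
Definition greenR : relation T :=
  fun a b => forall x, right_ideal1 a x <-> right_ideal1 b x.
Definition greenD : relation T :=
  fun a b => exists c, greenL a c /\ greenR c b.

Hypotheses (opA : associative op) (opxx : idempotent_op op).

Lemma band_greenLE a b : greenL a b <-> op a b = a /\ op b a = b.
Proof.
split=> [ab|[ab ba] x].
  split.
    have /ab[-> | [s ->]] : left_ideal1 a a by left.
      exact: opxx.
    by rewrite -opA opxx.
  have /ab[-> | [s ->]] : left_ideal1 b b by left.
    exact: opxx.
  by rewrite -opA opxx.
split=> -[-> | [s ->]]; right.
- by exists a.
- by exists (op s a); rewrite -opA ab.
- by exists b.
- by exists (op s b); rewrite -opA ba.
Qed.

Lemma band_greenRE a b : greenR a b <-> op a b = b /\ op b a = a.
Proof.
split=> [ab|[ab ba] x].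
  split.
    have /ab[-> | [s ->]] : right_ideal1 b b by left.
      exact: opxx.
    by rewrite opA opxx.
  have /ab[-> | [s ->]] : right_ideal1 a a by left.
    exact: opxx.
  by rewrite opA opxx.
split=> -[-> | [s ->]]; right.
- by exists a.
- by exists (op a s); rewrite opA ba.
- by exists b.
- by exists (op b s); rewrite opA ab.
Qed.

Lemma band_greenDE a b :
  greenD a b <-> op (op a b) a = a /\ op (op b a) b = b.
Proof.
split=> [[c [/band_greenLE[ac ca] /band_greenRE[cb bc]]]|[aba bab]].
  have abc : op (op a b) c = a by rewrite -opA bc.
  have cab : op (op c a) b = b by rewrite ca.
  split; first by rewrite -{2}abc opA opxx abc.
  by rewrite -{1}cab -!opA [op a (op b _)]opA opxx opA.
exists (op b a); split.
  by apply/band_greenLE; split; [rewrite opA|rewrite -opA opxx].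
by apply/band_greenRE; split; [|rewrite opA opxx].
Qed.

End Green.

Definition green_Lplus (S : semiring) : relation S := greenL (@sr_add S).
Definition green_Rplus (S : semiring) : relation S := greenR (@sr_add S).
Definition green_Ddot (S : semiring) : relation S := greenD (@sr_mul S).

Definition le_rplus (S : semiring) : relation S := fun a b => b = b + a.
Definition le_dot (S : semiring) : relation S := fun a b => a = b * a /\ a = a * b.

Record semiring_congruence (S : semiring) (rho : relation S) : Prop :=
  SemiringCongruence {
    cong_refl : forall x, rho x x;
    cong_sym : forall x y, rho x y -> rho y x;
    cong_trans : forall x y z, rho x y -> rho y z -> rho x z;
    cong_add : forall x x' y y', rho x x' -> rho y y' -> rho (x + y) (x' + y');
    cong_mul : forall x x' y y', rho x x' -> rho y y' -> rho (x * y) (x' * y') }.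

Section Quotient.
Variables (S : semiring) (rho : relation S).
Hypothesis rhoC : semiring_congruence rho.

Definition cong_rel : rel {classic S} := fun x y => `[< rho x y >].

Lemma cong_rel_refl : reflexive cong_rel.
Proof. by move=> x; apply/asboolP; exact: cong_refl rhoC _. Qed.

Lemma cong_rel_sym : symmetric cong_rel.
Proof. by move=> x y; apply/asboolP/asboolP; exact: cong_sym rhoC _ _. Qed.

Lemma cong_rel_trans : transitive cong_rel.
Proof.
move=> y x z /asboolP xy /asboolP yz; apply/asboolP.
exact: cong_trans rhoC _ _ _ xy yz.
Qed.

Definition cong_equiv : equiv_rel {classic S} :=
  EquivRel cong_rel cong_rel_refl cong_rel_sym cong_rel_trans.

Definition quot_sort : Type := {eq_quot cong_equiv}.

Definition quot_pi (x : S) : quot_sort := \pi_{eq_quot cong_equiv} (x : {classic S}).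
Definition quot_repr (q : quot_sort) : S := repr (q : {eq_quot cong_equiv}).

Definition quot_add (p q : quot_sort) : quot_sort :=
  quot_pi (quot_repr p + quot_repr q).
Definition quot_mul (p q : quot_sort) : quot_sort :=
  quot_pi (quot_repr p * quot_repr q).

Lemma quot_piP x y : quot_pi x = quot_pi y <-> rho x y.
Proof.
split=> [/(@eqmodP _ cong_equiv) /asboolP //|xy].
by apply/(@eqmodP _ cong_equiv)/asboolP.
Qed.

Lemma quot_reprK q : quot_pi (quot_repr q) = q.
Proof. exact: reprK. Qed.

Lemma quot_piD x y : quot_pi (x + y) = quot_add (quot_pi x) (quot_pi y).
Proof.
by apply/quot_piP/(cong_add rhoC); apply/quot_piP; rewrite quot_reprK.
Qed.

Lemma quot_piM x y : quot_pi (x * y) = quot_mul (quot_pi x) (quot_pi y).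
Proof.
by apply/quot_piP/(cong_mul rhoC); apply/quot_piP; rewrite quot_reprK.
Qed.

(* [quot_piD] and [quot_piM] make the operations independent of [repr]. *)
Lemma quot_addA : associative quot_add.
Proof.
move=> p q r; rewrite -(quot_reprK p) -(quot_reprK q) -(quot_reprK r).
by rewrite -!quot_piD sr_addA.
Qed.

Lemma quot_mulA : associative quot_mul.
Proof.
move=> p q r; rewrite -(quot_reprK p) -(quot_reprK q) -(quot_reprK r).
by rewrite -!quot_piM sr_mulA.
Qed.

Lemma quot_mulDl : left_distributive quot_mul quot_add.
Proof.
move=> p q r; rewrite -(quot_reprK p) -(quot_reprK q) -(quot_reprK r).
by rewrite -!(quot_piM, quot_piD) sr_mulDl.
Qed.

Lemma quot_mulDr : right_distributive quot_mul quot_add.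
Proof.
move=> p q r; rewrite -(quot_reprK p) -(quot_reprK q) -(quot_reprK r).
by rewrite -!(quot_piM, quot_piD) sr_mulDr.
Qed.

Definition quotient_semiring : semiring :=
  Semiring quot_addA quot_mulA quot_mulDl quot_mulDr.

End Quotient.

Definition lattice_semiring (d : Order.disp_t) (L : distrLatticeType d) :
    semiring :=
  @Semiring L Order.join Order.meet (@joinA _ L) (@meetA _ L)
    (@meetUl _ L) (@meetUr _ L).

Definition semiring_isomorphic (S T : semiring) : Prop :=
  exists f : S -> T,
    [/\ bijective f, {morph f : x y / x + y} & {morph f : x y / x * y}].

Definition is_distr_lattice (S : semiring) : Prop :=
  exists (d : Order.disp_t) (L : distrLatticeType d),
    semiring_isomorphic S (lattice_semiring L).

Definition distr_lattice_congruence (S : semiring) (rho : relation S) : Prop :=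
  exists rhoC : semiring_congruence rho,
    is_distr_lattice (quotient_semiring rhoC).

Definition least_distr_lattice_congruence (S : semiring) (rho : relation S) :
    Prop :=
  distr_lattice_congruence rho /\
  (forall sigma : relation S, distr_lattice_congruence sigma ->
     inclusion S rho sigma).

(* Main.v *)
From HB Require Import structures.
Require Import Defs.

(** Write [L+], [R+], [D.] for the three Green relations.

    Condition (1) is exploited through a homomorphism into a distributive
    lattice whose kernel is the given congruence: a lattice identity holds in
    [S] modulo that kernel.  The identity [(x /\ y /\ x) \/ x = x] gives the
    axiom of [RN], the commutativity of meet puts [D.] inside [R+] (from
    [a = a * b * a] and [b = b * a * b]), and the commutativity of join
    shows that every distributive lattice congruence contains [R+].  So [R+] is
    the least one as soon as it is one at all.

    If [L+] is contained in [R+] then [L+] is the equality, because related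
    elements satisfy both [a + b = a] and [a + b = b].  The additive band is
    then right regular, as [y + x] and [x + (y + x)] are always [L+]-related;
    and on a right regular band the relation [R] is a congruence with a
    commutative quotient.  Since [R+] is compatible with the product in any
    idempotent semiring, it becomes a semiring congruence.

    The identity [x = y * x * y + x] provides all of this.  It yields
    [x * y + x = x], which is absorption modulo [R+] and contains the axiom of
    [RN]; in [RN] one has [L+] inside [D.]; and the identity turns
    [a = a * b * a] and [b = b * a * b] into the two equations of [R+], so that
    [D.] lies inside [R+].  Hence [L+] is trivial, and the product commutes
    modulo [R+] because [x * y] and [y * x] are [D.]-related.  The quotient by
    [R+] is therefore a distributive lattice.

    The remaining implications are equational.  The step used repeatedly is
    that in [RN] the relation [b = b + a], multiplied by [a] on both sides,
    collapses to [a * b * a = a]. *)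

Set Implicit Arguments.
Unset Strict Implicit.
Unset Printing Implicit Defensive.

Import Order.TTheory.

Local Open Scope semiring_scope.

(** * Distributive lattices as semirings *)

(** The dual absorption law [x * (x + y) = x] follows from the one assumed here
    by distributivity and idempotence of the product. *)
Lemma is_distr_lattice_of_laws (S : semiring) :
  (forall x : S, x * x = x) ->
  commutative (@sr_add S) -> commutative (@sr_mul S) ->
  (forall x y : S, x + x * y = x) -> is_distr_lattice S.
Proof.
move=> mulxx addC mulC addKM.
have mulKD (y x : S) : x * (x + y) = x by rewrite sr_mulDr mulxx addKM.
have addMK (y x : S) : x + x * y = x by exact: addKM.
(* The order hierarchy requires a choice structure, which classical logic puts
   on a copy of the carrier of [S]. *)
pose le (x y : {classic S}) := (x * y : {classic S}) == x.
pose lt (x y : {classic S}) := (y != x) && le x y.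
pose L : distrLatticeType (Order.Disp tt tt) :=
  HB.pack_for (distrLatticeType (Order.Disp tt tt)) {classic S}
    (@Order.isMeetJoinDistrLattice.Build (Order.Disp tt tt) {classic S}
      le lt (@sr_mul S) (@sr_add S) (fun _ _ => erefl) (fun _ _ => erefl)
      mulC addC (@sr_mulA S) (@sr_addA S) mulKD addMK (@sr_mulDl S) mulxx).
exists (Order.Disp tt tt), L, id; split=> //.
by exists id.
Qed.

Lemma distr_lattice_congruence_of_laws (S : semiring) (rho : relation S) :
  semiring_congruence rho ->
  (forall x, rho (x * x) x) -> (forall x y, rho (x + y) (y + x)) ->
  (forall x y, rho (x * y) (y * x)) -> (forall x y, rho (x + x * y) x) ->
  distr_lattice_congruence rho.
Proof.
move=> rhoC mulxx addC mulC addKM; exists rhoC.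
have mulxxQ (p : quot_sort rhoC) : quot_mul p p = p.
  by rewrite -(quot_reprK p) -quot_piM; apply/quot_piP.
have addCQ (p q : quot_sort rhoC) : quot_add p q = quot_add q p.
  by rewrite -(quot_reprK p) -(quot_reprK q) -!quot_piD; apply/quot_piP.
have mulCQ (p q : quot_sort rhoC) : quot_mul p q = quot_mul q p.
  by rewrite -(quot_reprK p) -(quot_reprK q) -!quot_piM; apply/quot_piP.
have addKMQ (p q : quot_sort rhoC) : quot_add p (quot_mul p q) = p.
  rewrite -(quot_reprK p) -(quot_reprK q) -quot_piM -quot_piD.
  exact/quot_piP.
exact: (@is_distr_lattice_of_laws (quotient_semiring rhoC)
  mulxxQ addCQ mulCQ addKMQ).
Qed.

(** A distributive lattice congruence is the kernel of a homomorphism into a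
    distributive lattice; this is how lattice identities are pulled back to
    [S]. *)
Lemma distr_lattice_congruence_kernel (S : semiring) (rho : relation S) :
  distr_lattice_congruence rho ->
  exists (d : Order.disp_t) (L : distrLatticeType d) (f : S -> L),
    [/\ {morph f : x y / x + y >-> (x `|` y)%O},
        {morph f : x y / x * y >-> (x `&` y)%O} &
        forall x y, f x = f y <-> rho x y].
Proof.
move=> [rhoC [d [L [g [/bij_inj g_inj gD gM]]]]].
exists d, L, (fun x => g (quot_pi rhoC x)); split=> [x y|x y|x y].
- by rewrite quot_piD gD.
- by rewrite quot_piM gM.
- by split=> [/g_inj/quot_piP|/(quot_piP rhoC) ->].
Qed.

(** * Right regular bands *)

Section RightRegularBand.
Variables (T : Type) (op : T -> T -> T).
Hypotheses (opA : associative op) (opxx : idempotent_op op).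

(** [op y x] and [op x (op y x)] are always [L]-related. *)
Lemma right_regular_of_trivial_greenL :
  (forall a b, op a b = a -> op b a = b -> a = b) ->
  forall x y, op x (op y x) = op y x.
Proof.
move=> trivL x y; apply: trivL; first by rewrite -opA opxx.
by rewrite -opA [op x (op x _)]opA opxx opA opxx.
Qed.

Hypothesis op_rr : forall x y, op x (op y x) = op y x.

Let op_rrA x y z : op x (op y (op x z)) = op y (op x z).
Proof. by rewrite [op y _]opA opA op_rr. Qed.

(** Of the two occurrences of a letter in a product only the last one matters:
    both [op (op x y) (op y x)] and [op y x] have the last occurrences of [y]
    and [x] in this order. *)
Lemma right_regular_greenR_comm x y : greenR op (op x y) (op y x).
Proof.
have half u v : op (op u v) (op v u) = op v u.
  by rewrite -opA [op v (op v u)]opA opxx op_rr.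
by apply/(band_greenRE opA opxx); split.
Qed.

Lemma right_regular_greenR_op x x' y y' :
  greenR op x x' -> greenR op y y' -> greenR op (op x y) (op x' y').
Proof.
have half a a' b b' :
    op a a' = a' -> op b b' = b' -> op (op a b) (op a' b') = op a' b'.
  move=> aa' bb'.
  (* Insert [a] before [a'] to delete the first [a], then [b] before [b'] to
     delete the first [b]. *)
  by rewrite -opA -{1}aa' -[op (op a a') _]opA op_rrA [op a (op _ _)]opA aa'
    -{1}bb' op_rrA bb'.
move=> /(band_greenRE opA opxx)[xx' x'x] /(band_greenRE opA opxx)[yy' y'y].
by apply/(band_greenRE opA opxx); split; apply: half.
Qed.

End RightRegularBand.

(** * Idempotent semirings *)

Section IdempotentSemiring.
Variable S : semiring.
Hypothesis hS : idempotent_semiring S.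

Let addxx (x : S) : x + x = x. Proof. exact: hS.1. Qed.
Let mulxx (x : S) : x * x = x. Proof. exact: hS.2. Qed.

Let LplusE (a b : S) : green_Lplus a b <-> a + b = a /\ b + a = b.
Proof. exact: (band_greenLE (@sr_addA S) addxx). Qed.

Let RplusE (a b : S) : green_Rplus a b <-> a + b = b /\ b + a = a.
Proof. exact: (band_greenRE (@sr_addA S) addxx). Qed.

Let DdotE (a b : S) : green_Ddot a b <-> a * b * a = a /\ b * a * b = b.
Proof. exact: (band_greenDE (@sr_mulA S) mulxx). Qed.

Lemma green_Rplus_trans (a b c : S) :
  green_Rplus a b -> green_Rplus b c -> green_Rplus a c.
Proof. by move=> ab bc x; split=> [/ab/bc|/bc/ab]. Qed.

Lemma green_Rplus_mul (a a' b b' : S) :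
  green_Rplus a a' -> green_Rplus b b' -> green_Rplus (a * b) (a' * b').
Proof.
move=> /RplusE[aa' a'a] /RplusE[bb' b'b].
apply: (@green_Rplus_trans _ (a' * b)); apply/RplusE.
  by rewrite -!sr_mulDl aa' a'a.
by rewrite -!sr_mulDr bb' b'b.
Qed.

Lemma green_Ddot_mulC (x y : S) : green_Ddot (x * y) (y * x).
Proof.
have half (u v : S) : u * v * (v * u) * (u * v) = u * v.
  by rewrite -!sr_mulA [u * (u * v)]sr_mulA mulxx [v * (v * _)]sr_mulA mulxx
    sr_mulA mulxx.
by apply/DdotE.
Qed.

(** The axiom of [RN] is a lattice identity, so a priori it holds only modulo
    [R+]; but one of the two equations expressing that [x * y * x + x] and [x]
    are [R+]-related is [x * y * x + x + x = x], where idempotence removes the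
    last summand. *)
Lemma RN_Ddot_of_distr_lattice_congruence :
  distr_lattice_congruence (@green_Rplus S) ->
  variety_RN S /\ inclusion S (@green_Ddot S) (@green_Rplus S).
Proof.
move=> /distr_lattice_congruence_kernel[d [L [f [fD fM fP]]]]; split.
  split=> // x y.
  have /fP/RplusE[] : f (x * y * x + x) = f x.
    by rewrite fD !fM meetUK.
  by rewrite -sr_addA addxx.
move=> a b /DdotE[aba bab]; apply/fP.
by rewrite -aba -{2}bab !fM meetAC meetxx meetC [RHS]meetAC meetxx.
Qed.

(** Multiplying [b + a = b] by [a] on both sides gives [a * b * a + a =
    a * b * a], and the left-hand side is [a] by the axiom of [RN]. *)
Lemma RN_le_rplus_mul (a b : S) :
  variety_RN S -> le_rplus a b -> a * b * a = a.
Proof.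
move=> [_ rn] ba.
by rewrite -[RHS](rn a b) {1}ba sr_mulDr sr_mulDl !mulxx.
Qed.

Lemma RN_Lplus_sub_Ddot :
  variety_RN S -> inclusion S (@green_Lplus S) (@green_Ddot S).
Proof.
move=> rn a b /LplusE[ab ba].
by apply/DdotE; split; apply: RN_le_rplus_mul.
Qed.

Lemma trivial_Lplus :
  inclusion S (@green_Lplus S) (@green_Rplus S) ->
  forall a b : S, a + b = a -> b + a = b -> a = b.
Proof.
by move=> LR a b ab ba; have /RplusE[<- _] : green_Rplus a b by apply/LR/LplusE.
Qed.

(** Right regularity of the sum deletes the first summand of
    [x + x * y * x + x]. *)
Lemma RN_of_N :
  inclusion S (@green_Lplus S) (@green_Rplus S) -> variety_N S -> variety_RN S.
Proof.
move=> LR [_ n]; split=> // x y.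
rewrite -(right_regular_of_trivial_greenL (@sr_addA S) addxx) ?sr_addA //.
exact: trivial_Lplus.
Qed.

(** From [b = b + a] and [a * b * a = a], the elements [a * b] and [b * a] are
    both [D.]-related to [a], hence [R+]-related to it; on the other hand
    [b + a = b] multiplied by [a] makes them absorb [a] on their right. *)
Lemma RN_le_rplus_sub_le_dot :
  variety_RN S -> inclusion S (@green_Ddot S) (@green_Rplus S) ->
  inclusion S (@le_rplus S) (@le_dot S).
Proof.
move=> rn DR a b ba.
have aba := RN_le_rplus_mul rn ba.
have ab_a : a * b + a = a * b by rewrite {2}ba sr_mulDr mulxx.
have ba_a : b * a + a = b * a by rewrite {2}ba sr_mulDl mulxx.
have /DR/RplusE[_ aE] : green_Ddot a (a * b).
  by apply/DdotE; rewrite !sr_mulA mulxx aba mulxx.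
have /DR/RplusE[_ aE'] : green_Ddot a (b * a).
  by apply/DdotE; rewrite -[b * a * a]sr_mulA !mulxx sr_mulA aba mulxx.
by split; [rewrite -ba_a|rewrite -ab_a].
Qed.

(** Because the product is idempotent, [x = b * x * b] forces
    [b * x = x = x * b]; for [b = y + x] these are [y * x + x = x] and
    [x * y + x = x], and substituting the second in the first gives the
    result. *)
Lemma mul_sandwich_of_add_sandwich :
  (forall x y : S, x = (y + x) * x * (y + x)) ->
  forall x y : S, x = y * x * y + x.
Proof.
move=> h x y.
have absorb b : x = b * x * b -> b * x = x /\ x * b = x.
  move=> e; split; first by rewrite {1}e !sr_mulA mulxx -e.
  by rewrite {1}e -sr_mulA mulxx -e.
have [bx xb] := absorb _ (h x y).
have yx_x : y * x + x = x by rewrite -[RHS]bx sr_mulDl mulxx.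
have xy_x : x * y + x = x by rewrite -[RHS]xb sr_mulDr mulxx.
by rewrite -[LHS]yx_x -{1}xy_x sr_mulDr -sr_addA yx_x sr_mulA.
Qed.

(** * Consequences of the identity [x = y * x * y + x] *)

Section MulSandwich.
Hypothesis sandwich : forall x y : S, x = y * x * y + x.

Let mul_addK (x y : S) : x * y + x = x.
Proof.
by rewrite -[RHS]mulxx {4}(sandwich x y) sr_mulDr -[y * x * y]sr_mulA sr_mulA
  !mulxx.
Qed.

Lemma sandwich_RN : variety_RN S.
Proof.
by split=> // x y; rewrite -sr_mulA mul_addK.
Qed.

Lemma sandwich_Ddot_sub_Rplus : inclusion S (@green_Ddot S) (@green_Rplus S).
Proof.
move=> a b /DdotE[aba bab]; apply/RplusE; split.
  by rewrite -{1}aba -sandwich.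
by rewrite -{1}bab -sandwich.
Qed.

Let add_rr (x y : S) : x + (y + x) = y + x.
Proof.
apply: (right_regular_of_trivial_greenL (@sr_addA S) addxx).
apply: trivial_Lplus => a b /(RN_Lplus_sub_Ddot sandwich_RN).
exact: sandwich_Ddot_sub_Rplus.
Qed.

Lemma sandwich_Rplus_congruence : semiring_congruence (@green_Rplus S).
Proof.
split.
- by [].
- by move=> x y xy z; split=> /xy.
- exact: green_Rplus_trans.
- exact: (right_regular_greenR_op (@sr_addA S) addxx add_rr).
- exact: green_Rplus_mul.
Qed.

Lemma sandwich_Rplus_distr_lattice :
  distr_lattice_congruence (@green_Rplus S).
Proof.
apply: distr_lattice_congruence_of_laws => [|x|x y|x y|x y].
- exact: sandwich_Rplus_congruence.
- by rewrite mulxx.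
- exact: (right_regular_greenR_comm (@sr_addA S) addxx add_rr).
- exact/sandwich_Ddot_sub_Rplus/green_Ddot_mulC.
- apply/RplusE; split; last by rewrite sr_addA addxx.
  by rewrite -sr_addA mul_addK addxx.
Qed.

End MulSandwich.

Lemma Rplus_sub_distr_lattice_congruence (sigma : relation S) :
  distr_lattice_congruence sigma -> inclusion S (@green_Rplus S) sigma.
Proof.
move=> /distr_lattice_congruence_kernel[d [L [f [fD _ fP]]]].
by move=> a b /RplusE[ab ba]; apply/fP; rewrite -ab -{1}ba !fD joinC.
Qed.

End IdempotentSemiring.

Theorem corollary3p8 (S : semiring) (hS : idempotent_semiring S) :
  [<->
    least_distr_lattice_congruence (@green_Rplus S);
    variety_RN S /\ inclusion S (@green_Ddot S) (@green_Rplus S);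
    variety_N S /\ inclusion S (@green_Lplus S) (@green_Ddot S) /\
      inclusion S (@green_Ddot S) (@green_Rplus S);
    inclusion S (@le_rplus S) (@le_dot S);
    forall x y : S, x = (y + x) * x * (y + x);
    forall x y : S, x = y * x * y + x ].
Proof.
tfae.
- by case=> /(RN_Ddot_of_distr_lattice_congruence hS).
- move=> [rn DR]; split; last by split; first exact: RN_Lplus_sub_Ddot.
  by split=> // x y; rewrite -sr_addA rn.2 hS.1.
- move=> [n [LD DR]]; apply: RN_le_rplus_sub_le_dot => //.
  by apply: RN_of_N => // a b /LD/DR.
- move=> le_sub x y.
  have [<- <-] // : le_dot x (y + x).
  by apply: le_sub; rewrite /le_rplus -sr_addA hS.1.
- exact: mul_sandwich_of_add_sandwich.
- move=> sandwich; split; first exact: sandwich_Rplus_distr_lattice.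
  by move=> sigma; apply: Rplus_sub_distr_lattice_congruence.
Qed.
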